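(* Let $P$ be a unification problem with solved form $S=(\vec x=\vec u\wedge\vec y=\vec v)$, and let $\eta_S=\{\vec x\mapsto\vec u\}$, $R_S=\{\vec y\to\vec v\}$. Then the canonical $S$-based cyclic unifier $\langle\eta_S,R_S\rangle$ is most general among the $S$-based cyclic unifiers of $P$: it is a cyclic unifier of $P$, and for every cyclic unifier of $P$ of the form $\langle\eta,R_S\rangle$ there is a substitution $\tau$ with $\eta=\eta_S\tau$.
   Context: Terms are over a signature $\mathcal F$ and a denumerable set $\mathcal X$ of variables. $\mathcal Var(\cdot)$ denotes the set of variables. Substitutions are written postfix, $\mathcal Dom(\sigma)=\{x:\sigma(x)\ne x\}$ and $\mathcal Ran(\sigma)=\bigcup_{x\in\mathcal Dom(\sigma)}\mathcal Var(x\sigma)$. An equation is a pair of finite terms. A unification problem $P$ is a finite conjunction (multiset) of equations. A *solution* of $P$ is a ground substitution, whose values may be finite or infinite rational terms, making both sides of each equation equal. The set of ground terms is assumed non-empty. $|s|$ is the number of function symbol occurrences in $s$ (so $|s|=0$ iff $s$ is a variable). **Unification rules.** - Remove: $s=s\wedge P\to P$. - Decomp: $f(\vec s)=f(\vec t)\wedge P\to \vec s=\vec t\wedge P$. - Conflict: $f(\vec s)=g(\vec t)\wedge P\to\bot$ if $f\ne g$. - Choose: $y=x\wedge P\to x=y\wedge P$ if $x\notin\mathcal Var(P)$, $y\in\mathcal Var(P)$. - Coalesce: $x=y\wedge P\to x=y\wedge P\{x\mapsto y\}$ if $x,y\in\mathcal Var(P)$, $x\neq y$. - Swap: $u=x\wedge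 P\to x=u\wedge P$ if $u\notin\mathcal X$. - Merge: $x=s\wedge x=t\wedge P\to x=s\wedge s=t\wedge P$ if $x\in\mathcal X$, $0<|s|\le|t|$. - Replace: $x=s\wedge P\to x=s\wedge P\{x\mapsto s\}$ if $x\in\mathcal Var(P)$, $x\notin\mathcal Var(s)$, $s\notin\mathcal X$. - Merep: $y=x\wedge x=s\wedge P\to y=s\wedge x=s\wedge P$ if $x\in\mathcal Var(s)$, $s\notin\mathcal X$, $y\notin\mathcal Var(s,P)$, and no other rule applies. **Solved form of $P$.** A problem $S=(\vec x=\vec u\wedge\vec y=\vec v)$ obtained from $P$ by these rules such that, with $\mathcal P=\mathcal Var(P)\setminus(\vec x\cup\vec y)$ (the parameters): - the left-hand side variables $\vec x\cup\vec y$ are all distinct; - every $u$ in $\vec u$ has $\mathcal Var(u)\subseteq\mathcal P$; - every $v$ in $\vec v$ is not a variable, $\mathcal Var(v)\subseteq\mathcal P\cup\vec y$ and $\mathcal Var(v)\cap\vec y\neq\emptyset$. **Cyclic rewrite system.** A set of rules $R=\{\vec y\to\vec v\}$ such that $\vec y=\vec v$ is its own solved form with no finite part, i.e. the variables $\vec y$ are distinct and each $v$ is a non-variable term containing some variable of $\vec y$. Its variables are treated as constants when rewriting. For a set of equations $E$, $=^{cc}_E$ is the congruence closure of $E$: the equational theory generated by $E$ with the variables of $E$ treated as constants. $R\eta$ is obtained by applying $\eta$ to both sides of all rules of $R$. **Cyclic unifier of $P$.** A pair $\langle\eta,R\rangle$ of a substitution $\eta$ (with finite values) and a cyclic rewrite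 system $R=\{\vec y\to\vec v\}$ such that: - (i) $\mathcal Dom(\eta)\subseteq\mathcal Var(P)\setminus\vec y$, $\mathcal Ran(\eta)\cap\vec y=\emptyset$ and $\mathcal Ran(\eta)\cap\mathcal Dom(\eta)=\emptyset$; - (ii) $P$ and $P\wedge R$ (with $R$ read as equations) have the same set of solutions; - (iii) $a\eta=^{cc}_{R\eta}b\eta$ for every equation $a=b$ in $P$. A cyclic unifier is *$S$-based* if its cyclic rewrite system is $R_S$. If $\vec y=\emptyset$, $R_S$ is empty. *)

(* Defs.v *)
From mathcomp Require Import all_boot.
From Stdlib Require Import Permutation.

Set Implicit Arguments.
Unset Strict Implicit.
Unset Printing Implicit Defensive.

Section CyclicUnification.

Variables (F : Type) (ar : F -> nat) (X : eqType).

Inductive term : Type :=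
| Var (x : X)
| App (f : F) (a : {ffun 'I_(ar f) -> term}).

Definition is_var (t : term) : bool := if t is Var _ then true else false.

Fixpoint vars (t : term) : seq X :=
  match t with
  | Var x => [:: x]
  | App f a => flatten [seq vars (a i) | i <- enum 'I_(ar f)]
  end.

(* |t|, which counts function symbols only. *)
Fixpoint nsymb (t : term) : nat :=
  match t with
  | Var _ => 0
  | App f a => (\sum_(i < ar f) nsymb (a i)).+1
  end.

Definition subst : Type := X -> term.

Fixpoint app_subst (s : subst) (t : term) : term :=
  match t with
  | Var x => s x
  | App f a => App [ffun i => app_subst s (a i)]
  end.

(* Composition in diagrammatic order, as for postfix application:
   x (s t) = (x s) t. *)
Definition comp_subst (s t : subst) : subst := fun x => app_subst t (s x).

Definition in_dom (s : subst) (x : X) : Prop := s x <> Var x.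

Definition in_ran (s : subst) (z : X) : Prop :=
  exists2 x, in_dom s x & z \in vars (s x).

Definition equation : Type := (term * term)%type.

(* A multiset of equations is a list read modulo Permutation; equations are
   oriented. *)
Definition problem : Type := seq equation.

Definition pvars (P : problem) : seq X :=
  flatten [seq vars e.1 ++ vars e.2 | e <- P].

Definition psubst (s : subst) (P : problem) : problem :=
  [seq (app_subst s e.1, app_subst s e.2) | e <- P].

(* A list of bindings (x, u) serves both as the equations x = u and as the
   rewrite rules x -> u. *)
Definition bindings : Type := seq (X * term).

Definition lhs (B : bindings) : seq X := unzip1 B.

Definition eqns (B : bindings) : problem := [seq (Var b.1, b.2) | b <- B].

Fixpoint subst_of (B : bindings) : subst := fun z =>
  if B is (x, u) :: B' then if z == x then u else subst_of B' z else Var z.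

Definition subst1 (x : X) (s : term) : subst := subst_of [:: (x, s)].

(* All the rules except Merep, acting at the head of the list; None is the
   failed problem. *)
Inductive rule : problem -> option problem -> Prop :=
| Remove s P :
    rule ((s, s) :: P) (Some P)
| Decomp f (a b : {ffun 'I_(ar f) -> term}) P :
    rule ((App a, App b) :: P)
         (Some ([seq (a i, b i) | i <- enum 'I_(ar f)] ++ P))
| Conflict f g (a : {ffun 'I_(ar f) -> term}) (b : {ffun 'I_(ar g) -> term}) P :
    f <> g ->
    rule ((App a, App b) :: P) None
| Choose x y P :
    x \notin pvars P -> y \in pvars P ->
    rule ((Var y, Var x) :: P) (Some ((Var x, Var y) :: P))
| Coalesce x y P :
    x \in pvars P -> y \in pvars P -> x != y ->
    rule ((Var x, Var y) :: P)
         (Some ((Var x, Var y) :: psubst (subst1 x (Var y)) P))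
| Swap u x P :
    ~~ is_var u ->
    rule ((u, Var x) :: P) (Some ((Var x, u) :: P))
| Merge x s t P :
    0 < nsymb s <= nsymb t ->
    rule ((Var x, s) :: (Var x, t) :: P) (Some ((Var x, s) :: (s, t) :: P))
| Replace x s P :
    x \in pvars P -> x \notin vars s -> ~~ is_var s ->
    rule ((Var x, s) :: P) (Some ((Var x, s) :: psubst (subst1 x s) P)).

Definition basic_step (P : problem) (Q : option problem) : Prop :=
  exists2 P', Permutation P P' & rule P' Q.

Inductive step (P : problem) : option problem -> Prop :=
| Basic Q : basic_step P Q -> step P Q
| Merep x y s P' :
    Permutation P ((Var y, Var x) :: (Var x, s) :: P') ->
    x \in vars s -> ~~ is_var s -> y \notin vars s ++ pvars P' ->
    (forall Q, ~ basic_step P Q) ->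
    step P (Some ((Var y, s) :: (Var x, s) :: P')).

Inductive derives (P : problem) : problem -> Prop :=
| Derives_refl Q : Permutation P Q -> derives P Q
| Derives_step Q S : step P (Some Q) -> derives Q S -> derives P S.

(* S = (eqns xu ++ eqns yv) is a solved form of P, with finite part xu and
   cyclic part yv. *)
Definition solved_form (P : problem) (xu yv : bindings) : Prop :=
  let param z := (z \in pvars P) && (z \notin lhs xu ++ lhs yv) in
  [/\ derives P (eqns xu ++ eqns yv),
      uniq (lhs xu ++ lhs yv),
      forall x u, List.In (x, u) xu -> forall z, z \in vars u -> param z
    & forall y v, List.In (y, v) yv ->
        [/\ ~~ is_var v,
            forall z, z \in vars v -> param z || (z \in lhs yv)
          & exists2 z, z \in vars v & z \in lhs yv]].

Definition cyclic_system (R : bindings) : Prop := solved_form (eqns R) [::] R.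

(* The congruence closure of E: the variables of E are constants, so there is
   no closure under instantiation; for the variables outside E it is
   admissible. *)
Inductive cc (E : seq equation) : term -> term -> Prop :=
| cc_base a b : List.In (a, b) E -> cc E a b
| cc_refl a : cc E a a
| cc_sym a b : cc E a b -> cc E b a
| cc_trans a b c : cc E a b -> cc E b c -> cc E a c
| cc_cong f (a b : {ffun 'I_(ar f) -> term}) :
    (forall i, cc E (a i) (b i)) -> cc E (App a) (App b).

(* A finite or infinite ground term, as the labelling of its positions; None
   marks the sequences that are not positions. *)
Definition tree : Type := seq nat -> option F.

Definition is_ground_tree (t : tree) : Prop :=
  isSome (t [::]) /\
  forall p i, isSome (t (rcons p i)) = (if t p is Some f then i < ar f else false).

Definition is_rational (t : tree) : Prop :=
  exists L : seq tree, forall p, isSome (t p) ->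
    exists2 t', List.In t' L & forall q, t (p ++ q) = t' q.

Definition ground_rational (t : tree) : Prop :=
  is_ground_tree t /\ is_rational t.

Fixpoint eval (sigma : X -> tree) (t : term) : tree :=
  match t with
  | Var x => sigma x
  | App f a => fun p =>
      if p is i :: q then
        if insub i is Some j then eval sigma (a j) q else None
      else Some f
  end.

Definition solution (P : problem) (sigma : X -> tree) : Prop :=
  (forall x, ground_rational (sigma x)) /\
  (forall a b, List.In (a, b) P -> eval sigma a =1 eval sigma b).

Record cyclic_unifier (P : problem) (eta : subst) (R : bindings) : Prop := {
  cu_system : cyclic_system R;
  cu_dom : forall x, in_dom eta x -> x \in pvars P /\ x \notin lhs R;
  cu_ran_lhs : forall z, in_ran eta z -> z \notin lhs R;
  cu_ran_dom : forall z, in_ran eta z -> ~ in_dom eta z;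
  cu_solutions : forall sigma, solution P sigma <-> solution (P ++ eqns R) sigma;
  cu_cc : forall a b, List.In (a, b) P ->
    cc (psubst eta (eqns R)) (app_subst eta a) (app_subst eta b)
}.

End CyclicUnification.

(* Main.v *)
Require Import Defs.
From mathcomp Require Import all_boot.
From Stdlib Require Import Permutation.

(** Every unification rule is sound for any congruence on terms that is
    injective on function symbols, and its inverse is sound for any congruence
    at all.  Applied backwards to congruence closure this shows that <eta_S, R_S>
    is a cyclic unifier.

    For generality take tau := eta; only x eta = u eta, for x = u in the finite
    part of S, has to be proved.  The rules R_S eta unfold every term into a
    possibly infinite tree whose remaining variables are leaves.  Equality of
    the unfoldings of a eta and b eta is an injective congruence in a and b; it
    contains P by (iii), hence it contains S.  Finally x eta and u eta contain
    no variable of R_S, and on such terms unfolding is injective. *)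

Set Implicit Arguments.
Unset Strict Implicit.
Unset Printing Implicit Defensive.

Section Terms.

Variables (F : Type) (ar : F -> nat) (X : eqType).

Notation term := (term ar X).
Notation problem := (problem ar X).
Notation bindings := (bindings ar X).

(** * Terms, substitutions and lists of bindings *)

Lemma term_nested_ind (Q : term -> Prop) :
  (forall x, Q (Var ar x)) ->
  (forall f (a : {ffun 'I_(ar f) -> term}), (forall i, Q (a i)) -> Q (App a)) ->
  forall t, Q t.
Proof.
move=> QVar QApp; fix IH 1 => -[x|f a]; first exact: QVar.
by apply: QApp => i; apply: IH.
Qed.

Lemma mem_vars_App f (a : {ffun 'I_(ar f) -> term}) z :
  reflect (exists i, z \in vars (a i)) (z \in vars (App a)).
Proof.
apply: (iffP flatten_mapP) => [[i _ ?]|[i ?]]; first by exists i.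
by exists i; rewrite ?mem_enum.
Qed.

Lemma vars_app_subst (s : subst ar X) t z :
  z \in vars (app_subst s t) -> exists2 x, x \in vars t & z \in vars (s x).
Proof.
elim/term_nested_ind: t => [x|f a IH] /=; first by exists x; rewrite ?inE.
case/mem_vars_App=> i; rewrite ffunE => /IH[x xa zx].
by exists x => //; apply/mem_vars_App; exists i.
Qed.

Lemma app_subst_id (s : subst ar X) t :
  (forall z, z \in vars t -> s z = Var ar z) -> app_subst s t = t.
Proof.
elim/term_nested_ind: t => [x|f a IH] s_id /=; first by rewrite s_id ?inE.
congr App; apply/ffunP => i; rewrite ffunE; apply: IH => z zi.
by apply: s_id; apply/mem_vars_App; exists i.
Qed.

Lemma In_map A B (h : A -> B) s y :
  List.In y [seq h i | i <- s] <-> exists2 x, List.In x s & y = h x.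
Proof.
elim: s => [|x s IH] /=; first by split=> // -[].
split=> [[<-|/IH[x' ? ->]]|[x' [<-|x's] yx']].
- by exists x; first left.
- by exists x'; first right.
- by left.
- by right; apply/IH; exists x'.
Qed.

Lemma In_cat A (s t : seq A) x :
  List.In x (s ++ t) <-> List.In x s \/ List.In x t.
Proof. by elim: s => [|y s IH] /=; tauto. Qed.

Lemma In_mem (s : seq X) x : x \in s -> List.In x s.
Proof. by elim: s => //= y s IH; rewrite inE => /predU1P[->|/IH]; tauto. Qed.

Lemma mem_lhs (B : bindings) x : x \in lhs B -> exists u, List.In (x, u) B.
Proof. by move=> /In_mem/In_map[[z u] zB ->]; exists u. Qed.

Lemma In_lhs (B : bindings) x u : List.In (x, u) B -> x \in lhs B.
Proof.
elim: B => //= b B IH [->|/IH xB]; first exact: mem_head.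
by rewrite inE xB orbT.
Qed.

Lemma subst_of_notin (B : bindings) x : x \notin lhs B -> subst_of B x = Var ar x.
Proof.
by elim: B => //= -[y u] B IH; rewrite inE negb_or /= => /andP[/negPf-> /IH].
Qed.

Lemma subst_of_In (B : bindings) x u :
  uniq (lhs B) -> List.In (x, u) B -> subst_of B x = u.
Proof.
elim: B => //= -[y v] B IH /= /andP[yB uB] [[-> ->]|xB]; first by rewrite eqxx.
by case: eqP => [xy|_]; [rewrite -xy (In_lhs xB) in yB | apply: IH].
Qed.

Lemma In_eqns (B : bindings) e :
  List.In e (eqns B) <-> exists2 b, List.In b B & e = (Var ar b.1, b.2).
Proof. exact: In_map. Qed.

Lemma mem_pvars (P : problem) a b z :
  List.In (a, b) P -> (z \in vars a) || (z \in vars b) -> z \in pvars P.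
Proof.
elim: P => //= e P IH [->|abP] zab; rewrite /pvars /= !mem_cat ?zab //.
by rewrite [_ \in flatten _]IH ?orbT.
Qed.

(** * Relations on terms and the unification rules *)

Definition holds (E : term -> term -> Prop) (P : problem) : Prop :=
  forall a b, List.In (a, b) P -> E a b.

Lemma holds_cons E a b P : holds E ((a, b) :: P) <-> E a b /\ holds E P.
Proof.
split=> [EP|[Eab EP] c d /= [[<- <-]|]] //; last exact: EP.
by split=> [|c d cd]; apply: EP; [left | right].
Qed.

Lemma holds_cat E P Q : holds E (P ++ Q) <-> holds E P /\ holds E Q.
Proof.
split=> [EPQ|[EP EQ] a b /In_cat[/EP|/EQ]] //.
by split=> a b ab; apply: EPQ; apply/In_cat; tauto.
Qed.

Lemma holds_perm E P Q : Permutation P Q -> holds E P -> holds E Q.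
Proof. by move=> PQ EP a b /(Permutation_in _ (Permutation_sym PQ))/EP. Qed.

Lemma holds_psubst E s P :
  holds E (psubst s P) <->
  holds (fun a b => E (app_subst s a) (app_subst s b)) P.
Proof.
split=> [EP a b ab|EP a b /In_map[[c d] /EP ? [-> ->]]] //.
by apply: EP; apply/In_map; exists (a, b).
Qed.

Lemma holds_args E f (a b : {ffun 'I_(ar f) -> term}) :
  holds E [seq (a i, b i) | i <- enum 'I_(ar f)] <-> forall i, E (a i) (b i).
Proof.
split=> [Eab i|Eab c d /In_map[i _ [-> ->]]] //.
apply: Eab; apply/In_map; exists i => //.
have: i \in enum 'I_(ar f) by rewrite mem_enum.
by elim: (enum _) => //= j s IH; rewrite inE => /predU1P[->|/IH]; tauto.
Qed.

(** What Coalesce and Replace ask of [E], as [app_injective] is what Decomp asks. *)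
Definition subst_closed (E : term -> term -> Prop) : Prop :=
  forall x s a b, E (Var ar x) s -> E a b ->
  E (app_subst (subst1 x s) a) (app_subst (subst1 x s) b).

Definition app_injective (E : term -> term -> Prop) : Prop :=
  forall f (a b : {ffun 'I_(ar f) -> term}),
  E (App a) (App b) -> forall i, E (a i) (b i).

Record congruence (E : term -> term -> Prop) : Prop := {
  congr_refl : forall a, E a a;
  congr_sym : forall a b, E a b -> E b a;
  congr_trans : forall a b c, E a b -> E b c -> E a c;
  congr_App : forall f (a b : {ffun 'I_(ar f) -> term}),
    (forall i, E (a i) (b i)) -> E (App a) (App b)
}.

(** Pulling a congruence back along a substitution lets the rules act on [P] itself rather than on
    its instance. *)
Lemma congruence_app_subst E (s : subst ar X) : congruence E ->
  congruence (fun a b => E (app_subst s a) (app_subst s b)).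
Proof.
case=> refl sym trans cong; split=> [a|a b|a b c|f a b ab] /=; [exact: refl|..].
- exact: sym.
- exact: trans.
- by apply: cong => i; rewrite !ffunE.
Qed.

Lemma app_injective_app_subst E (s : subst ar X) : app_injective E ->
  app_injective (fun a b => E (app_subst s a) (app_subst s b)).
Proof. by move=> injE f a b /injE ab i; have := ab i; rewrite !ffunE. Qed.

Section Congruence.

Variables (E : term -> term -> Prop) (congE : congruence E).

(** The substitution changes [t] only at leaves [x], where [E] relates old and new; congruence
    carries this to the root. *)
Lemma congr_subst1 x s t : E (Var ar x) s -> E t (app_subst (subst1 x s) t).
Proof.
move=> Exs; elim/term_nested_ind: t => [z|f a IH] /=.
  by rewrite /subst1 /=; case: eqP => [->|_] //; apply: congr_refl.
by apply: congr_App => // i; rewrite ffunE.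
Qed.

Lemma congr_subst1E x s a b : E (Var ar x) s ->
  E (app_subst (subst1 x s) a) (app_subst (subst1 x s) b) <-> E a b.
Proof.
move=> Exs; split=> Eab.
  apply: congr_trans (congr_subst1 a Exs) _ => //.
  exact: congr_trans Eab (congr_sym _ (congr_subst1 b Exs)).
apply: congr_trans (congr_sym congE (congr_subst1 a Exs)) _ => //.
exact: congr_trans Eab (congr_subst1 b Exs).
Qed.

Lemma congr_subst_closed : subst_closed E.
Proof. by move=> x s a b Exs Eab; apply/congr_subst1E. Qed.

Lemma holds_psubst1 x s P :
  E (Var ar x) s -> holds E (psubst (subst1 x s) P) -> holds E P.
Proof. by move=> Exs /holds_psubst EP a b /EP/(congr_subst1E _ _ Exs). Qed.

Lemma rule_complete P Q : rule P (Some Q) -> holds E Q -> holds E P.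
Proof.
have [refl sym trans cong] := congE.
move QE: (Some Q) => oQ r; case: r QE => //.
- by move=> s P' [->] EQ; apply/holds_cons.
- move=> f a b P' [->] /holds_cat[/holds_args Eab EP].
  by apply/holds_cons; split=> //; apply: cong.
- move=> x y P' _ _ [->] /holds_cons[Exy EP].
  by apply/holds_cons; split=> //; apply: sym.
- move=> x y P' _ _ _ [->] /holds_cons[Exy EP].
  by apply/holds_cons; split=> //; apply: holds_psubst1 EP.
- move=> u x P' _ [->] /holds_cons[Exu EP].
  by apply/holds_cons; split=> //; apply: sym.
- move=> x s t P' _ [->] /holds_cons[Exs /holds_cons[Est EP]].
  by do 2![apply/holds_cons; split=> //]; apply: trans Est.
- move=> x s P' _ _ _ [->] /holds_cons[Exs EP].
  by apply/holds_cons; split=> //; apply: holds_psubst1 EP.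
Qed.

Lemma derives_complete P Q : derives P Q -> holds E Q -> holds E P.
Proof.
elim=> [{}P {}Q PQ|{}P Q1 S stepPQ _ IH /IH EQ].
  exact: holds_perm (Permutation_sym PQ).
move QE: (Some Q1) stepPQ => oQ st.
case: st QE => [{}oQ [P' PP' rP'] QE|y x s P' PP' _ _ _ _ [QE]].
  rewrite -QE in rP'.
  exact: holds_perm (Permutation_sym PP') (rule_complete rP' EQ).
apply: holds_perm (Permutation_sym PP') _.
move: EQ; rewrite QE => /holds_cons[Eys /holds_cons[Exs EP]].
apply/holds_cons; split; last exact/holds_cons.
(* Merep backwards: [y = x] follows from [y = s] and [x = s]. *)
exact: (congr_trans congE) Eys (congr_sym congE Exs).
Qed.

End Congruence.

(* Reflexivity is not assumed, so that this also covers the relation of having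
   all variables in a given set. *)
Section Soundness.

Variables (E : term -> term -> Prop).
Hypothesis sym : forall a b, E a b -> E b a.
Hypothesis trans : forall a b c, E a b -> E b c -> E a c.
Hypothesis inj : app_injective E.
Hypothesis closed : subst_closed E.

Let psubst1_holds x s P :
  E (Var ar x) s -> holds E P -> holds E (psubst (subst1 x s) P).
Proof. by move=> Exs EP; apply/holds_psubst => a b /EP; apply: closed. Qed.

Lemma rule_sound P Q : rule P (Some Q) -> holds E P -> holds E Q.
Proof.
move QE: (Some Q) => oQ r; case: r QE => //.
- by move=> s P' [->] /holds_cons[].
- move=> f a b P' [->] /holds_cons[Eab EP].
  by apply/holds_cat; split=> //; apply/holds_args/inj.
- move=> x y P' _ _ [->] /holds_cons[Eyx EP].
  by apply/holds_cons; split=> //; apply: sym.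
- move=> x y P' _ _ _ [->] /holds_cons[Exy EP].
  by apply/holds_cons; split=> //; apply: psubst1_holds.
- move=> u x P' _ [->] /holds_cons[Eux EP].
  by apply/holds_cons; split=> //; apply: sym.
- move=> x s t P' _ [->] /holds_cons[Exs /holds_cons[Ext EP]].
  by do 2![apply/holds_cons; split=> //]; apply: trans (sym Exs) Ext.
- move=> x s P' _ _ _ [->] /holds_cons[Exs EP].
  by apply/holds_cons; split=> //; apply: psubst1_holds.
Qed.

Lemma derives_sound P Q : derives P Q -> holds E P -> holds E Q.
Proof.
elim=> [{}P {}Q PQ|{}P Q1 S stepPQ _ IH EP]; first exact: holds_perm.
apply: IH; move QE: (Some Q1) stepPQ => oQ st.
case: st QE => [{}oQ [P' PP' rP'] QE|y x s P' PP' _ _ _ _ [->]].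
  by rewrite -QE in rP'; apply: rule_sound rP' (holds_perm PP' EP).
have /holds_cons[Eyx /holds_cons[Exs EP']] := holds_perm PP' EP.
by apply/holds_cons; split; [apply: trans Exs | apply/holds_cons].
Qed.

End Soundness.

(** Soundness for the relation that both sides have all their variables in [pvars P]. It is closed
    under [subst1 x s] because a related [s] only brings in variables of [P]. *)
Lemma derives_vars (P Q : problem) a b z :
  derives P Q -> List.In (a, b) Q -> (z \in vars a) || (z \in vars b) ->
  z \in pvars P.
Proof.
move=> PQ abQ.
pose E (a b : term) := forall z, (z \in vars a) || (z \in vars b) -> z \in pvars P.
apply: (derives_sound (E := E) _ _ _ _ PQ _ abQ).
- by move=> c d Ecd w; rewrite orbC; apply: Ecd.
- move=> c d e Ecd Ede w /orP[wc|we]; first by apply: Ecd; rewrite wc.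
  by apply: Ede; rewrite we orbT.
- move=> f c d Ecd i w /orP[]wi; apply: Ecd; apply/orP; [left|right];
    by apply/mem_vars_App; exists i.
- move=> x s c d Exs Ecd w.
  have Esubst t : {subset vars t <= pvars P} ->
      {subset vars (app_subst (subst1 x s) t) <= pvars P}.
    move=> tP v /vars_app_subst[u ut]; rewrite /subst1 /=.
    case: eqP => [_ vs|_]; first by apply: Exs; rewrite vs orbT.
    by rewrite inE => /eqP->; apply: tP.
  by case/orP; apply: Esubst => v vt; apply: Ecd; rewrite vt ?orbT.
- by move=> c d cdP w; apply: mem_pvars cdP.
Qed.

(** * Two congruences: equality of values and congruence closure *)

Lemma eval_congruence (sigma : X -> tree F) :
  congruence (fun a b => eval sigma a =1 eval sigma b).
Proof.
split=> [a|a b ab|a b c ab bc|f a b ab] p //; first by rewrite ab bc.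
by case: p => //= i q; case: insubP => // j _ _; apply: ab.
Qed.

Lemma eval_app_injective (sigma : X -> tree F) :
  app_injective (fun a b => eval sigma a =1 eval sigma b).
Proof. by move=> f a b ab i p; have := ab (val i :: p); rewrite /= valK. Qed.

Lemma cc_congruence E : congruence (cc E).
Proof.
split; [exact: cc_refl | exact: cc_sym | exact: cc_trans | exact: cc_cong].
Qed.

(** Used to turn condition (iii) into equality of unfoldings. *)
Lemma cc_min E E' a b : congruence E -> holds E E' -> cc E' a b -> E a b.
Proof.
move=> [refl sym trans cong] EE'.
elim=> [c d|//|c d _|c d e _ Ecd _|f c d _]; last exact: cong.
- exact: (EE' c d).
- exact: sym.
- exact: trans.
Qed.

(** * Unfolding terms by a cyclic rewrite system *)

Section Unfolding.

Variable R : bindings.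

Definition resolve (t : term) : term := if t is Var z then subst_of R z else t.

(* The labels at the positions of the tree obtained from [t] by applying the
   rules of [R] forever; [inr z] labels a leaf [z].  The recursion is on the
   position, which is why the rules of [R] must not have a variable of [R] as
   right-hand side. *)
Fixpoint unfolding (t : term) (p : seq nat) : option (F + X) :=
  match resolve t, p with
  | Var z, [::] => Some (inr z)
  | Var z, _ :: _ => None
  | App f _, [::] => Some (inl f)
  | App f a, i :: q => if insub i is Some j then unfolding (a j) q else None
  end.

(** One direction gives injectivity on function symbols, the other congruence. *)
Lemma unfolding_App f (a b : {ffun 'I_(ar f) -> term}) :
  unfolding (App a) =1 unfolding (App b) <->
  forall i, unfolding (a i) =1 unfolding (b i).
Proof.
split=> [ab i p|ab [|i q] //=]; first by have := ab (val i :: p); rewrite /= valK.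
by case: insubP => // j _ _; apply: ab.
Qed.

Lemma unfolding_congruence :
  congruence (fun a b => unfolding a =1 unfolding b).
Proof.
split=> [a|a b ab p|a b c ab bc p|f a b ab] //; first by rewrite ab.
exact/unfolding_App.
Qed.

(** As [v] is an application, [resolve] sends both sides to [v]; distinct left-hand sides ensure
    that the lookup of [y] finds this rule. *)
Lemma unfolding_rule y v :
  uniq (lhs R) -> List.In (y, v) R -> ~~ is_var v ->
  unfolding (Var ar y) =1 unfolding v.
Proof.
by move=> uR yR; case: v yR => // f a yR _ [|i q] /=; rewrite (subst_of_In uR yR).
Qed.

(** No rule applies anywhere in such terms, so the labels of the unfolding spell out the term. *)
Lemma unfolding_inj s t :
  (forall z, z \in vars s -> z \notin lhs R) ->
  (forall z, z \in vars t -> z \notin lhs R) ->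
  unfolding s =1 unfolding t -> s = t.
Proof.
elim/term_nested_ind: s t => [x|f a IH] [y|g b] sR tR st; have := st [::] => /=.
- have [xR yR] := (sR x (mem_head _ _), tR y (mem_head _ _)).
  by rewrite !subst_of_notin // => -[->].
- by rewrite subst_of_notin ?sR ?mem_head.
- by rewrite subst_of_notin ?tR ?mem_head.
(* The root labels give [f = g]; eliminating this equation gives both argument families the same
   type. *)
case=> fg; case: g / fg b tR st => b tR /unfolding_App st.
congr App; apply/ffunP => i; apply: IH => // z zi; [apply: sR|apply: tR];
  by apply/mem_vars_App; exists i.
Qed.

End Unfolding.

(** * The canonical cyclic unifier and its generality *)

Section SolvedForm.

Variables (P : problem) (xu yv : bindings).
Hypothesis solvedP : solved_form P xu yv.

Let PS : derives P (eqns xu ++ eqns yv).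
Proof. by case: solvedP. Qed.

Let disjoint_lhs x : x \in lhs xu -> x \notin lhs yv.
Proof.
case: solvedP => _ + _ _; rewrite cat_uniq => /and3P[_ /hasPn yx _] xl.
by apply/negP => /yx; rewrite /= xl.
Qed.

Let uniq_xu : uniq (lhs xu).
Proof. by case: solvedP => _; rewrite cat_uniq => /and3P[]. Qed.

Let uniq_yv : uniq (lhs yv).
Proof. by case: solvedP => _; rewrite cat_uniq => /and3P[]. Qed.

Let vars_xu x u z :
  List.In (x, u) xu -> z \in vars u -> z \notin lhs xu /\ z \notin lhs yv.
Proof.
case: solvedP => _ _ xu_param _ xuP zu.
by have := xu_param _ _ xuP _ zu; rewrite mem_cat negb_or => /and3P[].
Qed.

Let nonvar_yv y v : List.In (y, v) yv -> ~~ is_var v.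
Proof. by case: solvedP => _ _ _ yv_ok /yv_ok[]. Qed.

Lemma in_dom_subst_of (B : bindings) x : in_dom (subst_of B) x -> x \in lhs B.
Proof. by move=> dx; apply/negPn/negP => /subst_of_notin. Qed.

Lemma canonical_ran z :
  in_ran (subst_of xu) z -> z \notin lhs xu /\ z \notin lhs yv.
Proof.
case=> x /in_dom_subst_of/mem_lhs[u xuP].
by rewrite (subst_of_In uniq_xu xuP); apply: vars_xu xuP.
Qed.

(** No rule step is needed. Parameters are now taken relative to [eqns yv], so any variable of a
    right-hand side outside [lhs yv] is one. *)
Lemma cyclic_part_system : cyclic_system yv.
Proof.
split=> //; first exact: Derives_refl.
move=> y v yvP; case: solvedP => _ _ _ /(_ y v yvP)[nv _ [z zv zy]].
split=> // [w wv|]; last by exists z.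
rewrite /= orbC; case: (w \in lhs yv) => //=; rewrite andbT.
apply: (mem_pvars (a := Var ar y) (b := v)); last by rewrite wv orbT.
by apply/In_eqns; exists (y, v).
Qed.

Lemma canonical_cyclic_unifier : cyclic_unifier P (subst_of xu) yv.
Proof.
split=> [|x /in_dom_subst_of xl|z /canonical_ran[] //|z /canonical_ran[zx _]||].
- exact: cyclic_part_system.
- split; last exact: disjoint_lhs.
  have [u xuP] := mem_lhs xl.
  apply: (derives_vars (a := Var ar x) (b := u) PS); last by rewrite mem_head.
  by apply/In_cat; left; apply/In_eqns; exists (x, u).
- by move/in_dom_subst_of; rewrite (negPf zx).
- move=> sigma; split=> -[gr Psol]; split=> // a b; last first.
    by move=> abP; apply: Psol; apply/In_cat; left.
  case/In_cat=> [/Psol //|abR].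
  (* A solution of [P] satisfies all equations of the solved form, in particular those of [yv]. *)
  have congE := eval_congruence sigma.
  apply: (derives_sound (congr_sym congE) (congr_trans congE)
    (@eval_app_injective sigma) (congr_subst_closed congE) PS Psol).
  by apply/In_cat; right.
(* Condition (iii) is checked on the solved form and carried back to [P]: in [x = u] both sides
   become [u], and [y = v] becomes a generator of the closure. *)
- apply: (derives_complete (congruence_app_subst _ (cc_congruence _)) PS).
  apply/holds_cat; split=> a b /In_eqns[[x u] xP [-> ->]] /=.
    rewrite (subst_of_In uniq_xu xP) app_subst_id; first exact: cc_refl.
    by move=> z /(vars_xu xP)[zx _]; apply: subst_of_notin.
  apply: cc_base; apply/In_map; exists (Var ar x, u) => //.
  by apply/In_eqns; exists (x, u).
Qed.

Lemma cyclic_unifier_lhs eta y :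
  cyclic_unifier P eta yv -> y \in lhs yv -> eta y = Var ar y.
Proof.
move=> eta_unif yl.
have ndom : ~ in_dom eta y by case/(cu_dom eta_unif); rewrite yl.
(* Equality on [F], hence on terms, need not be decidable, so the double negation is removed by
   inspecting [eta y]. *)
case ey: (eta y) => [z|f a]; last by case: ndom; rewrite /in_dom ey.
by case: (z =P y) => [->//|zy]; case: ndom; rewrite /in_dom ey => -[].
Qed.

(** If [eta] moves [x], then [z] is in its range, which avoids [lhs yv] by (i); if not, [z] is
    [x]. *)
Lemma cyclic_unifier_vars eta x z :
  cyclic_unifier P eta yv -> x \notin lhs yv -> z \in vars (eta x) ->
  z \notin lhs yv.
Proof.
move=> eta_unif xl zx; apply/negP => zl.
have ndom : ~ in_dom eta x.
  by move=> dx; have /(cu_ran_lhs eta_unif) : in_ran eta z; [exists x | rewrite zl].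
by apply: ndom => ex; move: zx xl; rewrite ex inE => /eqP<-; rewrite zl.
Qed.

Lemma cyclic_unifier_finite_part eta x u :
  cyclic_unifier P eta yv -> List.In (x, u) xu -> eta x = app_subst eta u.
Proof.
move=> eta_unif xuP.
(* This is the instance of the rules by [eta]: left-hand sides can be kept because [eta] fixes
   them. *)
pose R : bindings := [seq (b.1, app_subst eta b.2) | b <- yv].
have lhsR : lhs R = lhs yv by rewrite /lhs /unzip1 -map_comp; apply: eq_map.
have unfold_cc a b : cc (psubst eta (eqns yv)) a b -> unfolding R a =1 unfolding R b.
  apply: cc_min (unfolding_congruence R) _.
  apply/holds_psubst => c d /In_eqns[[y v] yvP [-> ->]] /=.
  rewrite (cyclic_unifier_lhs eta_unif (In_lhs yvP)).
  apply: unfolding_rule; first by rewrite lhsR.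
    by apply/In_map; exists (y, v).
  by case: (v) (nonvar_yv yvP).
have congE := congruence_app_subst eta (unfolding_congruence R).
have injE : app_injective (fun a b => unfolding R a =1 unfolding R b).
  by move=> f a b /unfolding_App.
apply: (@unfolding_inj R) => [z zx|z zu|]; rewrite ?lhsR.
- exact: cyclic_unifier_vars eta_unif (disjoint_lhs (In_lhs xuP)) zx.
- have [w wu zw] := vars_app_subst zu.
  by apply: cyclic_unifier_vars eta_unif _ zw; case: (vars_xu xuP wu).
(* Soundness takes equality of unfoldings after [eta] from [P] to [x = u]. *)
apply: (derives_sound (congr_sym congE) (congr_trans congE)
  (app_injective_app_subst (s := eta) injE) (congr_subst_closed congE)
  PS _ (a := Var ar x)).
  by move=> a b /(cu_cc eta_unif)/unfold_cc.
by apply/In_cat; left; apply/In_eqns; exists (x, u).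
Qed.

End SolvedForm.

End Terms.

Theorem theorem18 (F : Type) (ar : F -> nat) (X : countType)
    (X_infinite : forall s : seq X, exists x : X, x \notin s)
    (ground_nonempty : exists t : tree F, ground_rational ar t)
    (P : problem ar X) (xu yv : bindings ar X) :
  solved_form P xu yv ->
  cyclic_unifier P (subst_of xu) yv /\
  (forall eta : subst ar X, cyclic_unifier P eta yv ->
     exists tau : subst ar X, eta =1 comp_subst (subst_of xu) tau).
Proof.
move=> solvedP; split=> [|eta eta_unif]; first exact: canonical_cyclic_unifier.
exists eta => z; rewrite /comp_subst.
have [/mem_lhs[u zu]|zl] := boolP (z \in lhs xu); last by rewrite subst_of_notin.
rewrite (cyclic_unifier_finite_part solvedP eta_unif zu) (subst_of_In _ zu) //.
by case: solvedP => _; rewrite cat_uniq => /and3P[].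
Qed.
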